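(* Let $\kappa$ be a strongly inaccessible cardinal and let $\theta$ be an ordinal with $2\le \theta<\kappa$. Then $\mathrm{HL}_{1,\theta}(\kappa)$ holds; that is, for every coloring $c:{}^{\kappa>}2\to\theta$ there are $A\in[\kappa]^{\kappa}$ and a regular subtree $T\subseteq{}^{\kappa>}2$ such that (i) for every $\eta\in T$, both $\eta^{\frown}\langle 0\rangle$ and $\eta^{\frown}\langle 1\rangle$ belong to $T$ if and only if $\mathrm{lg}(\eta)\in A$, and (ii) $c$ is constant on $\{\eta\in T:\mathrm{lg}(\eta)\in A\}$.
   Context: For an ordinal $\kappa$, ${}^{\kappa>}2=\bigcup_{\alpha<\kappa}{}^{\alpha}2$ is the set of binary sequences of length less than $\kappa$; $\mathrm{lg}(\eta)$ is the $\alpha$ with $\eta\in{}^{\alpha}2$; $\eta\trianglelefteq\nu$ means $\eta$ is an initial segment of $\nu$. A subtree is a nonempty subset of ${}^{\kappa>}2$ closed under initial segments. A subtree $T\subseteq{}^{\kappa>}2$ is regular if (1) for all $\eta\in T$ and $\alpha<\kappa$ there is $\nu\in T$ with $\eta\trianglelefteq\nu$ and $\mathrm{lg}(\nu)=\max\{\mathrm{lg}(\eta),\alpha\}$, and (2) whenever $\delta<\kappa$ is a limit ordinal and $\eta\in{}^{\delta}2$ satisfies $\eta\restriction\alpha\in T$ for all $\alpha<\delta$, then $\eta\in T$. *)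

(* Defs.v *)
From mathcomp Require Import all_boot all_order.
From mathcomp Require Import boolp classical_sets functions cardinality.
From mathcomp Require Import wochoice.

Set Implicit Arguments.
Unset Strict Implicit.
Unset Printing Implicit Defensive.

Import Order.TTheory.
Local Open Scope classical_set_scope.
Local Open Scope card_scope.
Local Open Scope order_scope.

(* An ordinal kappa is given as a well-ordered type K. The points of K are the
   ordinals alpha < kappa, and the segment [oseg alpha] is alpha itself, as the
   set of the smaller ordinals. *)
Definition oseg {d : Order.disp_t} {K : orderType d} (alpha : K) : Type :=
  {x : K | x < alpha}.

Definition card_lt {T U : Type} (A : set T) (B : set U) : bool :=
  (A #<= B) && ~~ (B #<= A).

Section Ordinals.
Context {d : Order.disp_t} {K : orderType d}.
Implicit Types (alpha beta delta theta : K) (A : set K).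

Definition is_osucc alpha beta : Prop :=
  alpha < beta /\ forall x : K, x < beta -> x <= alpha.

(* The junk value [alpha] occurs only if alpha is the largest point of K;
   see [osuccP] below. *)
Definition osucc alpha : K := xget alpha [set beta | is_osucc alpha beta].

Definition is_limit delta : Prop :=
  (exists x : K, x < delta) /\
  forall x : K, x < delta -> exists y : K, x < y < delta.

(* 2 = {0, 1} <= theta: theta has at least two elements. *)
Definition ge_two theta : Prop := exists a b : K, a < b < theta.

Definition cofinal_in A : Prop := forall x : K, exists2 a, A a & x <= a.

End Ordinals.

Definition is_ordinal {d : Order.disp_t} (K : orderType d) : Prop :=
  well_order (<=%O : rel K).

(* A cardinal is an initial ordinal. *)
Definition is_cardinal {d : Order.disp_t} (K : orderType d) : Prop :=
  is_ordinal K /\ forall alpha : K, card_lt [set: oseg alpha] [set: K].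

(* cf(kappa) = kappa *)
Definition regular_cardinal {d : Order.disp_t} (K : orderType d) : Prop :=
  is_cardinal K /\ forall A : set K, cofinal_in A -> A #= [set: K].

Definition strong_limit {d : Order.disp_t} (K : orderType d) : Prop :=
  forall alpha : K, card_lt [set: set (oseg alpha)] [set: K].

Definition strongly_inaccessible {d : Order.disp_t} (K : orderType d) : Prop :=
  [/\ ~ countable [set: K], regular_cardinal K & strong_limit K].

(* The binary sequences of length less than kappa. *)
Record binseq {d : Order.disp_t} (K : orderType d) : Type := BinSeq {
  lg : K;
  bval : oseg lg -> bool
}.
Arguments BinSeq {d K} lg bval.
Arguments lg {d K} b.
Arguments bval {d K} b x.

Section Sequences.
Context {d : Order.disp_t} {K : orderType d}.
Implicit Types (eta nu : binseq K) (alpha delta : K) (T : set (binseq K)).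

Definition initseg eta nu : Prop :=
  lg eta <= lg nu /\
  forall (x : K) (xe : x < lg eta) (xn : x < lg nu),
    bval eta (exist _ x xe) = bval nu (exist _ x xn).

Lemma lt_min_lg eta alpha (x : K) : x < Order.min alpha (lg eta) -> x < lg eta.
Proof. by rewrite lt_min => /andP[]. Qed.

(* Total version of the restriction: it is eta itself if lg eta <= alpha. *)
Definition restr eta alpha : binseq K :=
  BinSeq (Order.min alpha (lg eta))
    (fun x => bval eta (exist _ (sval x) (lt_min_lg (svalP x)))).

Definition snoc eta (b : bool) : binseq K :=
  BinSeq (osucc (lg eta))
    (fun x => if @idP (sval x < lg eta) is ReflectT xe
              then bval eta (exist _ (sval x) xe) else b).

Definition subtree T : Prop :=
  T !=set0 /\ forall eta nu, initseg eta nu -> T nu -> T eta.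

Definition regular_subtree T : Prop :=
  [/\ subtree T,
      forall eta alpha, T eta ->
        exists nu, [/\ T nu, initseg eta nu & lg nu = Order.max (lg eta) alpha]
    & forall delta eta, is_limit delta -> lg eta = delta ->
        (forall alpha, alpha < delta -> T (restr eta alpha)) -> T eta].

End Sequences.

Lemma osuccP {d : Order.disp_t} {K : orderType d} (alpha : K) :
  strongly_inaccessible K -> is_osucc alpha (osucc alpha).
Proof.
move=> [_ [[wo _] _] sl]; apply: xgetPex.
have [y ay] : exists y, alpha < y.
  apply: contrapT => noy.
  have le_a x : x <= alpha.
    by rewrite leNgt; apply/negP => ax; apply: noy; exists x.
  have /andP[_ /negP] := sl alpha; apply; apply/pcard_injP.
  pose f x : set (oseg alpha) := [set y | sval y < x]; exists f.
  suff f_lt x y : f x = f y -> ~ (x < y).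
    move=> x y _ _ fxy; apply/eqP; rewrite eq_le !leNgt.
    by apply/andP; split; apply/negP; apply: f_lt.
  move=> fxy xy; have xa : x < alpha := lt_le_trans xy (le_a y).
  have : f y (exist _ x xa) by [].
  by rewrite -fxy /f /= ltxx.
have [|z [[za zmin] _]] := wo (fun x => alpha < x); first by exists y.
exists z; split=> // x xz; rewrite leNgt; apply/negP => ax.
by have := zmin x ax; rewrite leNgt xz.
Qed.

(* Main.v *)
(** Call a colour [i] dense above a node [eta] if for every level [g >= lg eta]
there is a level [be >= g] such that every extension of [eta] of length [g] has
an extension of length [be] and colour [i].  Some colour is dense above some
node: otherwise, a level having fewer than kappa nodes, there are levels
[s j], increasing with [j <= theta], such that every node of length [s j] has an
extension below level [s (j + 1)] none of whose extensions of length [s theta]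
has colour [j]; passing through these extensions yields a node of length
[s theta] without colour.

Given [eta0] and [i] dense above it, choose stages [s j] (j < kappa) with
[be (s k) < s j] for [k < j], and let [A] be the set of the [be (s j)].  The tree
consists of the nodes whose entries off [A] obey a rule: follow [eta0], and on
[[s j, be (s j))] follow the chosen extension of colour [i] of the restriction
to [s j].  A tree given by such a rule is regular and splits exactly on [A]. *)

Require Import Defs.
From mathcomp Require Import all_boot all_order.
From mathcomp Require Import boolp classical_sets functions cardinality.

Local Open Scope classical_set_scope.
Local Open Scope card_scope.
Local Open Scope order_scope.

Import Order.TTheory.

Set Implicit Arguments.
Unset Strict Implicit.
Unset Printing Implicit Defensive.

(** * Transfinite recursion and functions that obey a rule *)

Section WellOrder.
Context {d : Order.disp_t} {K : orderType d}.
Hypothesis woK : is_ordinal K.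

Lemma lt_well_founded : well_founded (fun x y : K => x < y).
Proof.
move=> x0; apply: contrapT => nacc.
have [|z [[nz zmin] _]]   := @woK (fun x => `[< ~ Acc (fun x y : K => x < y) x >]).
  by exists x0; apply/asboolP.
move/asboolP: nz; apply; constructor => y yz; apply: contrapT => ny.
by have := zmin y (asboolT ny); rewrite leNgt yz.
Qed.

Lemma lt_recursion (P : Type) (F : forall x : K, (forall y, y < x -> P) -> P) :
  exists f : K -> P, forall x, f x = F x (fun y _ => f y).
Proof.
exists (Fix lt_well_founded (fun=> P) F) => x.
apply: (Fix_eq lt_well_founded (fun=> P) F) => {}x f g fg.
by congr F; apply: functional_extensionality_dep => y;
  apply: functional_extensionality_dep => yx; apply: fg.
Qed.

Definition agree (g : K) (b b' : K -> bool) : Prop :=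
  forall x, x < g -> b x = b' x.

Lemma agree_sym g b b' : agree g b b' -> agree g b' b.
Proof. by move=> h x xg; rewrite h. Qed.

Lemma agree_trans g b b' b'' : agree g b b' -> agree g b' b'' -> agree g b b''.
Proof. by move=> h h' x xg; rewrite h // h'. Qed.

Lemma agree_le g g' b b' : g' <= g -> agree g b b' -> agree g' b b'.
Proof. by move=> gg h x xg; apply: h; apply: lt_le_trans gg. Qed.

(** A node of length [g] is treated as a total function modulo [agree g]; this is the canonical
    representative of its class. *)
Definition trunc (g : K) (b : K -> bool) : K -> bool :=
  fun x => (x < g) && b x.

Lemma agree_trunc g b : agree g (trunc g b) b.
Proof. by move=> x xg; rewrite /trunc xg. Qed.

Lemma eq_trunc g b b' : agree g b b' -> trunc g b = trunc g b'.
Proof.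
move=> h; apply/funext => x; rewrite /trunc.
by case: (boolP (x < g)) => //= /h ->.
Qed.

Definition prefix_determined (p : K -> (K -> bool) -> bool) : Prop :=
  forall x b b', agree x b b' -> p x b = p x b'.

Lemma follow_rule p g b0 : prefix_determined p ->
  exists b, agree g b b0 /\ forall x, g <= x -> b x = p x b.
Proof.
move=> ploc.
(* The default [false] is harmless, since [p] at [x] depends only on the entries below [x]. *)
have [b bE] := @lt_recursion bool (fun x r => if x < g then b0 x else
  p x (fun y => if @idP (y < x) is ReflectT h then r y h else false)).
exists b; split=> x xg; rewrite bE ?xg // ltNge xg /=.
by apply: ploc => y yx; case: {-}_ / idP.
Qed.

(* The index found by [cid] is unambiguous only if the intervals [s i, t i) are
   pairwise disjoint, as in [interval_ruleE]. *)
Definition interval_rule (s t : K -> K) (e : K -> (K -> bool) -> K -> bool) x b :=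
  if pselect (exists i, s i <= x < t i) is left h then
    e (projT1 (cid h)) (trunc (s (projT1 (cid h))) b) x
  else false.

Lemma interval_rule_prefix s t e : prefix_determined (interval_rule s t e).
Proof.
move=> x b b' bb'; rewrite /interval_rule; case: pselect => // h.
case: cid => i /= /andP[six _].
by rewrite (eq_trunc (agree_le six bb')).
Qed.

(** By disjointness, every [x] in [[s i, t i)] selects the index [i]. The function being copied
    depends only on [b] below [s i], so it stays the same throughout the interval. *)
Lemma interval_ruleE s t e b i :
  (forall i j, i < j -> t i <= s j) -> agree (s i) (e i (trunc (s i) b)) b ->
  (forall x, s i <= x < t i -> b x = interval_rule s t e x b) ->
  agree (t i) b (e i (trunc (s i) b)).
Proof.
move=> ts es be x xt; have [xs|sx] := ltP x (s i); first by rewrite es.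
rewrite be ?sx // /interval_rule; case: pselect => [h|[]]; last first.
  by exists i; rewrite sx.
case: cid => j /= /andP[sjx xtj].
have [ij|ji|->//] := ltgtP i j.
  by have := lt_le_trans xt (le_trans (ts _ _ ij) sjx); rewrite ltxx.
by have := lt_le_trans xtj (le_trans (ts _ _ ji) sx); rewrite ltxx.
Qed.

End WellOrder.

Arguments agree_trunc {d K} g b.
Arguments interval_rule_prefix {d K} s t e.

(** * Stages, dense colours and homogeneous levels below an inaccessible cardinal *)

Section Inaccessible.
Context {d : Order.disp_t} {K : orderType d}.
Hypothesis inacc : strongly_inaccessible K.

Let woK : is_ordinal K. Proof. by case: inacc => _ [[]]. Qed.

(** An unbounded range would be cofinal, hence of size kappa by regularity, although it is an image
    of [T]. *)
Lemma small_bounded (T : Type) (f : T -> K) :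
  card_lt [set: T] [set: K] -> exists m, forall t, f t < m.
Proof.
move=> /andP[_ /negP TK]; apply: contrapT => nb; apply: TK.
have [_ [_ reg] _] := inacc.
have cof : cofinal_in (range f).
  move=> x; apply: contrapT => nx; apply: nb; exists x => t.
  by rewrite ltNge; apply/negP => xt; apply: nx; exists (f t) => //; exists t.
have /card_eqPle[_ Kf] := reg _ cof.
exact: card_le_trans Kf (card_image_le f setT).
Qed.

(** The truncations at [g] are coded by subsets of [oseg g], and there are fewer than kappa of these
    because kappa is a strong limit. *)
Lemma level_bounded (g : K) (f : (K -> bool) -> K) :
  exists m, forall b, f (trunc g b) < m.
Proof.
have [_ _ sl] := inacc.
pose ch (S : set (oseg g)) x := `[< exists h : x < g, S (exist _ x h) >].
have [m mP] := @small_bounded _ (f \o ch) (sl g).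
exists m => b; have := mP [set y | b (sval y)]; congr (f _ < m).
apply/funext => x; rewrite /ch /trunc; apply/asboolP/andP => [[h] //|[h bx]].
by exists h.
Qed.

(** Recursion on [j]: the values [G i (s i)] for [i < j] are indexed by [oseg j], which is smaller
    than the cardinal kappa, so they are bounded. *)
Lemma gap_sequence (g0 : K) (G : K -> K -> K) : exists s : K -> K,
  [/\ forall j, g0 <= s j, forall j, j <= s j
    & forall i j, i < j -> G i (s i) < s j].
Proof.
have [_ [[_ small] _] _] := inacc.
have bnd j (r : oseg j -> K) : exists m,
    [/\ g0 <= m, j <= m & forall y, r y < m].
  have [m mP] := @small_bounded _ r (small j).
  exists (Order.max m (Order.max g0 j)).
  by split=> [||y]; rewrite ?lt_max ?mP // !le_max lexx ?orbT.
have [s sE] := @lt_recursion _ _ woK K (fun j r =>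
  projT1 (cid (bnd j (fun y => G (sval y) (r (sval y) (svalP y)))))).
exists s; split=> [j|j|i j ij]; rewrite [s j]sE; case: cid => m [h1 h2 h3] //.
exact: (h3 (exist _ i ij)).
Qed.

Lemma somewhere_dense_colour (theta : K) (c : (K -> bool) -> K -> K) :
  (forall b g, c b g < theta) ->
  (forall g b b', agree g b b' -> c b g = c b' g) ->
  exists b0 g0 i, forall g, g0 <= g -> exists2 be, g <= be &
    forall b, agree g0 b b0 -> exists2 b', agree g b' b & c b' be = i.
Proof.
move=> cth cloc; apply: contrapT => no.
pose avoid g i be b' := forall b'', agree g b'' b' -> c b'' be <> i.
have fail b0 g0 i : exists g, g0 <= g /\ forall be, g <= be ->
    exists2 b', agree g0 b' b0 & avoid g i be b'.
  apply: contrapT => nf; apply: no; exists b0, g0, i => g g0g.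
  apply: contrapT => nbe; apply: nf; exists g; split=> // be gbe.
  apply: contrapT => nb'; apply: nbe; exists be => // b bb0.
  apply: contrapT => nb; apply: nb'; exists b => // b'' b''b cb.
  by apply: nb; exists b''.
(* One level [g] now serves all nodes of length [g0] at once; raising [g] only weakens [avoid]. *)
have ufail g0 i : exists g, g0 <= g /\ forall b0 be, g <= be ->
    exists2 b', agree g0 b' b0 & avoid g i be b'.
  have [f fP] := choice (fun b => fail b g0 i).
  have [m mP] := level_bounded g0 f.
  have g0m : g0 <= m := le_trans (fP _).1 (ltW (mP xpred0)).
  exists m; split=> // b be mbe.
  have [|b' b'b av] := (fP (trunc g0 b)).2 be.
    exact: le_trans (ltW (mP b)) mbe.
  exists b'; first exact: agree_trans b'b (agree_trunc _ _).
  by move=> b'' /(agree_le (ltW (mP b))); apply: av.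
have [G GP] := choice (fun gi => ufail gi.1 gi.2).
have [s [ths _ sP]] := gap_sequence theta (fun i g => G (g, i)).
pose t i := G (s i, i); pose be := s theta.
have /choice[e eP] : forall i, exists e : (K -> bool) -> K -> bool,
    i < theta -> forall b, agree (s i) (e b) b /\ avoid (t i) i be (e b).
  move=> i; have [ith|] := boolP (i < theta); last by exists id.
  have /choice[e eP] : forall b, exists b', agree (s i) b' b /\ avoid (t i) i be b'.
    move=> b; have [|b' ? ?] := (GP (s i, i)).2 b be; last by exists b'.
    exact: ltW (sP _ _ ith).
  by exists e.
(* All stages lie above [theta], so the values of [b] below [theta] are arbitrary. *)
have [b [_ bE]] :=
  follow_rule woK theta xpred0 (interval_rule_prefix s t e).
(* Diagonal step: take [i] to be the colour of [b] itself at [be]. Up to [t i], [b] follows an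
   extension that avoids this very colour. *)
have [es av] := eP (c b be) (cth b be) (trunc (s (c b be)) b).
apply: (av b) => //; apply: (@interval_ruleE _ _ s t e) => [i j ij||x /andP[sx _]].
- exact: ltW (sP _ _ ij).
- exact: agree_trans es (agree_trunc _ _).
- by apply: bE; apply: le_trans sx.
Qed.

Lemma homogeneous_levels (theta : K) (c : (K -> bool) -> K -> K) :
  (forall b g, c b g < theta) ->
  (forall g b b', agree g b b' -> c b g = c b' g) ->
  exists (A : set K) (p : K -> (K -> bool) -> bool) (i : K),
    [/\ A #= [set: K], prefix_determined p
      & forall a b, A a -> (forall x, x < a -> ~ A x -> b x = p x b) ->
          c b a = i].
Proof.
move=> cth cloc; have [b0 [g0 [i dense]]] := somewhere_dense_colour cth cloc.
have /choice[be beP] : forall g, exists be, g0 <= g -> g <= be /\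
    forall b, agree g0 b b0 -> exists2 b', agree g b' b & c b' be = i.
  move=> g; have [g0g|] := boolP (g0 <= g); last by exists g.
  by have [be ? ?] := dense g g0g; exists be.
have [s [g0s js sP]] := gap_sequence g0 (fun=> be).
pose t j := be (s j).
have st j : s j <= t j by have [] := beP _ (g0s j).
have /choice[e eP] : forall jb : K * (K -> bool), exists b', agree g0 jb.2 b0 ->
    agree (s jb.1) b' jb.2 /\ c b' (t jb.1) = i.
  move=> [j b] /=; have [bb0|] := pselect (agree g0 b b0); last by exists b.
  by have [b' ? ?] := (beP _ (g0s j)).2 b bb0; exists b'.
pose e' j b := e (j, b).
pose p x b := if x < g0 then b0 x else interval_rule s t e' x b.
exists (range t), p, i; split.
(* [A] is cofinal because [x <= s x <= t x]. *)
- have [_ [_ reg] _] := inacc; apply: reg => x.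
  by exists (t x); [exists x|apply: le_trans (js x) (st x)].
- move=> x b b' bb'; rewrite /p; case: ifP => // _.
  exact: interval_rule_prefix.
- move=> _ b [j _ <-] bp.
  (* The levels [t k] with [k < j] lie below [s j], and those with [k > j] lie above [t j]; so the
     rule is in force on the whole interval. *)
  have nA x : s j <= x < t j -> ~ range t x.
    move=> /andP[sx xt] [k _ tk].
    have [jk|kj|jk] := ltgtP j k.
    + move: xt; rewrite -tk ltNge => /negP; apply.
      exact: le_trans (ltW (sP _ _ jk)) (st k).
    + by have := lt_le_trans (sP _ _ kj) sx; rewrite -/(t k) tk ltxx.
    + by rewrite -tk jk ltxx in xt.
  have bb0 : agree g0 b b0.
    move=> x xg; rewrite bp /p ?xg //.
      exact: lt_le_trans xg (le_trans (g0s j) (st j)).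
    move=> [k _ tk]; have := lt_le_trans xg (le_trans (g0s k) (st k)).
    by rewrite tk ltxx.
  have [es ec] : agree (s j) (e' j (trunc (s j) b)) (trunc (s j) b) /\
      c (e' j (trunc (s j) b)) (t j) = i.
    apply: (eP (j, _)) => /=.
    exact: agree_trans (agree_le (g0s j) (agree_trunc _ _)) bb0.
  rewrite -ec; apply: cloc; apply: (@interval_ruleE _ _ s t e') => [k l kl||x sxt].
  + exact: ltW (sP _ _ kl).
  + exact: agree_trans es (agree_trunc _ _).
  + have /andP[sx xt] := sxt; rewrite bp // ?/p; last exact: nA.
    by rewrite ltNge (le_trans (g0s j) sx).
Qed.

(** * Translation between binary sequences and total functions *)

Definition seq_ext (eta : binseq K) : K -> bool :=
  fun x => if @idP (x < lg eta) is ReflectT h then bval eta (exist _ x h) else false.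

Definition seq_of (b : K -> bool) (g : K) : binseq K :=
  BinSeq g (fun x => b (sval x)).

Lemma seq_extE eta x (h : x < lg eta) : seq_ext eta x = bval eta (exist _ x h).
Proof.
by rewrite /seq_ext; case: {-}_ / idP => // h'; rewrite (bool_irrelevance h' h).
Qed.

Lemma seq_ofK b g : agree g (seq_ext (seq_of b g)) b.
Proof. by move=> x xg; rewrite (seq_extE (eta := seq_of b g) xg). Qed.

Lemma seq_extK eta : seq_of (seq_ext eta) (lg eta) = eta.
Proof.
case: eta => g f; rewrite /seq_of /=; congr BinSeq; apply/funext => -[x xg] /=.
exact: (seq_extE (eta := BinSeq g f) xg).
Qed.

Lemma initsegP eta nu :
  initseg eta nu <-> lg eta <= lg nu /\ agree (lg eta) (seq_ext eta) (seq_ext nu).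
Proof.
split=> -[le h]; split=> // x xe.
  by rewrite (seq_extE xe) (seq_extE (lt_le_trans xe le)).
by move=> xn; rewrite -!seq_extE h.
Qed.

Lemma restr_ext eta alpha : alpha <= lg eta ->
  lg (restr eta alpha) = alpha /\ agree alpha (seq_ext (restr eta alpha)) (seq_ext eta).
Proof.
move=> le; have lgE : lg (restr eta alpha) = alpha by rewrite /= min_l.
split=> // x xa; have xr : x < lg (restr eta alpha) by rewrite lgE.
by rewrite (seq_extE xr) (seq_extE (lt_le_trans xa le)) /=; congr bval; apply: val_inj.
Qed.

Lemma snoc_ext eta b :
  agree (lg eta) (seq_ext (snoc eta b)) (seq_ext eta) /\
  seq_ext (snoc eta b) (lg eta) = b.
Proof.
have [lts _] := osuccP (lg eta) inacc.
split=> [x xe|].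
  have xs : x < lg (snoc eta b) := lt_trans xe lts.
  by rewrite (seq_extE xs) /seq_ext /=; case: {-}_ / idP.
rewrite (seq_extE (eta := snoc eta b) lts) /=; case: {-}_ / idP => // h.
by have := h; rewrite ltxx.
Qed.

(** * Trees given by a rule: regularity and splitting *)

Definition rule_tree (A : set K) (p : K -> (K -> bool) -> bool) : set (binseq K) :=
  [set eta | forall x, x < lg eta -> ~ A x -> seq_ext eta x = p x (seq_ext eta)].

Lemma rule_tree_agree A p eta nu : prefix_determined p ->
  lg eta <= lg nu -> agree (lg eta) (seq_ext eta) (seq_ext nu) ->
  rule_tree A p nu -> rule_tree A p eta.
Proof.
move=> ploc le h Tnu x xe nA; rewrite h // Tnu ?(lt_le_trans xe) //.
by apply: ploc; apply: agree_sym; apply: agree_le h; apply: ltW.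
Qed.

(** A node is prolonged by following [p] beyond its length. The limit clause holds because the
    condition at each [x] concerns only the entries up to [x]. *)
Lemma rule_tree_regular A p : prefix_determined p -> regular_subtree (rule_tree A p).
Proof.
move=> ploc.
have ext eta alpha : rule_tree A p eta -> exists nu,
    [/\ rule_tree A p nu, initseg eta nu & lg nu = Order.max (lg eta) alpha].
  move=> Teta; have [b [bb0 bE]] := follow_rule woK (lg eta) (seq_ext eta) ploc.
  pose m := Order.max (lg eta) alpha.
  have em : lg eta <= m by rewrite le_max lexx.
  exists (seq_of b m); split=> //.
    move=> x xm nA; rewrite seq_ofK //.
    have -> : p x (seq_ext (seq_of b m)) = p x b.
      by apply: ploc; apply: agree_le (@seq_ofK _ _); apply: ltW.
    have [xe|] := ltP x (lg eta); last exact: bE.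
    rewrite bb0 // Teta //; apply: ploc; apply: agree_sym.
    exact: agree_le (ltW xe) bb0.
  apply/initsegP; split=> //; apply: agree_sym.
  exact: agree_trans (agree_le em (@seq_ofK _ _)) bb0.
split=> //.
  split; last by move=> eta nu /initsegP[le h]; apply: rule_tree_agree.
  have [x0 _] : exists x0 : K, True.
    have [nc _ _] := inacc; apply: contrapT => nx; apply: nc.
    suff -> : [set: K] = set0 by exact: countable0.
    by apply/seteqP; split=> x // _; apply: nx; exists x.
  (* The root is the sequence whose length is the least point of [K]; it satisfies the rule
     vacuously. *)
  have [|z [[_ zmin] _]] := @woK predT; first by exists x0.
  by exists (seq_of xpred0 z) => x /=; rewrite ltNge zmin.
move=> delta eta + lgE; case: delta / lgE => -[_ lim] Tr x xe nA.
have [y /andP[xy ye]] := lim x xe.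
have [lgr agr] := restr_ext (ltW ye).
rewrite -agr // (Tr y ye) ?lgr //.
by apply: ploc; apply: agree_le agr; apply: ltW.
Qed.

(** The only new condition is at position [lg eta]: the entry there is free on [A] and forced by [p]
    off [A]. Hence splitting occurs exactly on [A]. *)
Lemma rule_tree_snoc A p eta b : prefix_determined p -> rule_tree A p eta ->
  rule_tree A p (snoc eta b) <-> A (lg eta) \/ b = p (lg eta) (seq_ext eta).
Proof.
move=> ploc Teta; have [agr last] := snoc_ext eta b.
have [lts les] := osuccP (lg eta) inacc; split=> [Ts|h x /les].
  have [|nA] := pselect (A (lg eta)); [by left|right].
  by rewrite -[LHS]last Ts //; apply: ploc.
rewrite le_eqVlt => /orP[/eqP -> nA|xe nA].
  by case: h => [//|bE]; rewrite last [LHS]bE; apply: ploc; apply: agree_sym.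
rewrite agr // Teta //; apply: ploc; apply: agree_sym.
exact: agree_le (ltW xe) agr.
Qed.

End Inaccessible.

Theorem theorem1p4 (d : Order.disp_t) (kappa : orderType d)
    (kappa_inacc : strongly_inaccessible kappa)
    (theta : kappa) (theta_ge2 : ge_two theta)
    (c : binseq kappa -> oseg theta) :
  exists (A : set kappa) (T : set (binseq kappa)),
    [/\ A #= [set: kappa],
        regular_subtree T,
        forall eta : binseq kappa, T eta ->
          (T (snoc eta false) /\ T (snoc eta true) <-> A (lg eta))
      & exists i : oseg theta,
          forall eta : binseq kappa, T eta -> A (lg eta) -> c eta = i].
Proof.
pose c' b g := sval (c (seq_of b g)).
have cth b g : c' b g < theta by exact: (svalP (c (seq_of b g))).
have cloc g b b' : agree g b b' -> c' b g = c' b' g.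
  move=> h; congr (sval (c (BinSeq g _))); apply/funext => -[x xg] /=.
  exact: h.
have [A [p [i [cA ploc hom]]]] := homogeneous_levels kappa_inacc cth cloc.
exists A, (rule_tree A p); split=> //.
- exact: rule_tree_regular.
- move=> eta Teta; split=> [[]|Aeta]; last first.
    by split; apply/rule_tree_snoc => //; left.
  move=> /(rule_tree_snoc kappa_inacc _ ploc Teta)[//|pf].
  by move=> /(rule_tree_snoc kappa_inacc _ ploc Teta)[//|]; rewrite -pf.
- have col eta : rule_tree A p eta -> A (lg eta) -> sval (c eta) = i.
    by move=> Teta Aeta; rewrite -(hom _ _ Aeta Teta) /c' seq_extK.
  (* The colour [i] is only known as a point of kappa, so an element of [oseg theta] is read off
     from a node; without a node on a level in [A], any value of [c] will do. *)
  have [[eta [Teta Aeta]]|no] :=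
      pselect (exists eta, rule_tree A p eta /\ A (lg eta)).
    exists (c eta) => nu Tnu Anu; apply: val_inj.
    by rewrite [LHS]col // [RHS]col.
  exists (c (seq_of xpred0 theta)) => eta Teta Aeta.
  by case: no; exists eta.
Qed.
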